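(* Let $G$ be of type $E_6$ or $E_7$, let $P=P_I$ be a minuscule parabolic subgroup of $G$, let $w\in W^I$ with $w\ne1$, and let $\widehat w=(w_1,\ldots,w_m)$ be a generalised reduced decomposition of $w$ obtained by Construction 1 for an ordering of the peaks of $Q_w$ such that $\widehat X(\widehat w)$ is smooth. Let $\alpha$ be the unique simple root such that $w_1^{-1}(\alpha)$ is a negative root. Then $$w_1^{-1}(\alpha)\ \ge\ w^{-1}(\alpha).$$ Further, $w_1^{-1}(\alpha)=w^{-1}(\alpha)$ if and only if $w=w_1$, that is, $m=1$.
   Context: Groups. $G$ is a simply connected simple algebraic group of simply-laced type over an algebraically closed field, $T\subset B\subset G$ a maximal torus and a Borel subgroup, $R$ the root system with positive roots $R^+$ (roots of $B$) and simple roots $S=\{\alpha_1,\ldots,\alpha_n\}$, $W=N_G(T)/T$ the Weyl group with simple reflections $s_i=s_{\alpha_i}$, length $\ell$ and Bruhat order $\le$. For characters $\lambda,\mu$ of $T$, $\lambda\ge\mu$ means that $\lambda-\mu$ is a nonnegative integral linear combination of simple roots. For $J\subset S$, $P_J$ is the parabolic subgroup generated by $B$ and representatives of $s_\alpha$, $\alpha\in J$; $W_J=\langle s_\alpha:\alpha\in J\rangle$; $W^J=\{w\in W: w(\beta)\in R^+\ \forall\beta\in J\}$; $P^{\alpha}=P_{S\setminus\{\alpha\}}$. A minuscule parabolic subgroup is $P=P^\alpha$ with $\alpha$ a minuscule simple root, i.e. $\langle\varpi_\alpha,\beta^\vee\rangle\le1$ for all $\beta\in R^+$; in Bourbaki numbering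 the minuscule simple roots are $\alpha_1,\alpha_6$ for $E_6$ and $\alpha_7$ for $E_7$. Schubert varieties. For $w\in W$: $\mathrm{Supp}(w)$ is the set of simple roots whose reflections occur in a reduced decomposition of $w$; $G_w$ is the subgroup generated by the root subgroups $U_{\pm\alpha}$, $\alpha\in\mathrm{Supp}(w)$; $I^w=\{\alpha\in S: w(\alpha)\in R^+\}$, $P^w=P_{I^w}$; $X(w)$ is the closure of $BwP^w/P^w$ in $G/P^w$; $I_w=\{\alpha\in S: s_\alpha w\le w\text{ in }W/W_{I^w}\}$ and $P_w=P_{I_w}$, the stabiliser of $X(w)$ in $G$. Quiver. Fix a reduced decomposition $w=s_{i_1}\cdots s_{i_k}$ and put $\beta(j)=\alpha_{i_j}$. The successor of $i\in[1,k]$ is $s(i)=\min\{j>i:\beta(j)=\beta(i)\}$ if it exists. The quiver $Q_w$ has vertex set $[1,k]$ and an arrow $i\to j$ if $\langle\beta(j)^\vee,\beta(i)\rangle\ne0$ and $i<j<s(i)$ (only $i<j$ if $s(i)$ does not exist). Let $\preceq_Q$ be the partial order on vertices generated by $i\preceq_Q j$ whenever there is an arrow $i\to j$. Peaks are the minimal vertices for $\preceq_Q$. (The quiver does not depend on the reduced decomposition.) Construction 1. Choose any ordering $(p_1,\ldots,p_m)$ of the set of peaks of $Q_w$. Define inductively $V_t$ as the set of vertices $v\notin V_1\cup\cdots\cup V_{t-1}$ such that $p_u\not\preceq_Q v$ for all $u>t$; let $w_t$ be the product of the $s_{\beta(v)}$, $v\in V_t$, in increasing order of $v$. Then $w=w_1\cdots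 w_m$, $\ell(w)=\sum_t\ell(w_t)$, and $\widehat w=(w_1,\ldots,w_m)$ is the generalised reduced decomposition obtained by Construction 1. It is known that there is exactly one simple root $\alpha$ with $w_1^{-1}(\alpha)$ negative. The variety $\widehat X(\widehat w)$. Put $u_i=w_i\cdots w_m$. One has $P^{w_i}\cap G_{w_i}\subset P_{u_{i+1}}$. Set $\widehat X(w_m)=X(w_m)$ and recursively $\widehat X(w_i,\ldots,w_m)=\overline{(P_{w_i}\cap G_{w_i})w_i(P^{w_i}\cap G_{w_i})}\times^{P^{w_i}\cap G_{w_i}}\widehat X(w_{i+1},\ldots,w_m)$ (closure in $G_{w_i}$), where $P_{u_{i+1}}$ acts on $\widehat X(w_{i+1},\ldots,w_m)$. $\widehat X(\widehat w)$ is smooth if and only if $X(w_1),\ldots,X(w_m)$ are all smooth; by Perrin's criterion this holds if and only if, for every $t$, the simple root $\beta(p_t)$ is minuscule in the root subsystem generated by $\mathrm{Supp}(w_t)$. *)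

(* Defs.v *)
From HB Require Import structures.
From mathcomp Require Import all_boot all_order all_algebra.
From mathcomp Require Import boolp classical_sets.
From mathcomp Require Import mpoly.
Set Implicit Arguments.
Unset Strict Implicit.
Unset Printing Implicit Defensive.
Import Order.TTheory GRing.Theory Num.Theory.
Local Open Scope classical_set_scope.
Local Open Scope ring_scope.

(** * Root systems and Weyl groups

   A generalised Cartan matrix is written [C i j] = <alpha_j, alpha_i^vee>.
   Elements of the root lattice are column vectors of coordinates in the basis
   of simple roots, and the Weyl group is the group of integer matrices
   generated by the simple reflections.  The vertices of the Dynkin diagram
   are numbered from 0. *)

(* Bourbaki's E_n, whose edges are 1-3, 3-4, 2-4, 4-5, 5-6, 6-7. *)
Definition edgeE (i j : nat) : bool :=
  (i, j) \in [:: (0, 2); (2, 3); (1, 3); (3, 4); (4, 5); (5, 6)]%N.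

Definition cartanE (n : nat) : 'M[int]_n :=
  \matrix_(i, j) if i == j then 2 else if edgeE i j || edgeE j i then -1 else 0.

Section Weyl.
Variables (n : nat) (C : 'M[int]_n).

Definition simple_root (i : 'I_n) : 'cV[int]_n := delta_mx i 0.

(* s_i (alpha_j) = alpha_j - C i j * alpha_i *)
Definition srefl (i : 'I_n) : 'M[int]_n := 1%:M - delta_mx i i *m C.

Definition word (s : seq 'I_n) : 'M[int]_n :=
  foldr (fun i g => srefl i *m g) 1%:M s.

Definition weyl : set 'M[int]_n := range word.

Definition reduced (s : seq 'I_n) : Prop :=
  forall s', word s' = word s -> (size s <= size s')%N.

Definition is_root (v : 'cV[int]_n) : Prop :=
  exists s i, v = word s *m simple_root i.

Definition pos_root (v : 'cV[int]_n) : Prop :=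
  is_root v /\ forall i, 0 <= v i 0.

Definition neg_root (v : 'cV[int]_n) : Prop := pos_root (- v).

(* [root_ge v u]: v - u is a nonnegative combination of simple roots. *)
Definition root_ge (v u : 'cV[int]_n) : Prop := forall i, u i 0 <= v i 0.

Definition supp (w : 'M[int]_n) : set 'I_n :=
  [set i | exists s, [/\ reduced s, word s = w & i \in s]].

Definition parabolic_weyl (J : set 'I_n) : set 'M[int]_n :=
  [set w | exists s, w = word s /\ forall i, i \in s -> J i].

Definition min_reps (J : set 'I_n) : set 'M[int]_n :=
  [set w | weyl w /\ forall i, J i -> pos_root (w *m simple_root i)].

Definition reflection (t : 'M[int]_n) : Prop :=
  exists s i, t = word s *m srefl i *m invmx (word s).

Definition shorter (u v : 'M[int]_n) : Prop :=
  exists s s', [/\ reduced s, reduced s', word s = u, word s' = v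
                 & (size s < size s')%N].

Inductive bruhat (u : 'M[int]_n) : 'M[int]_n -> Prop :=
| bruhat_refl : bruhat u u
| bruhat_step v t : bruhat u v -> reflection t -> shorter v (v *m t) ->
    bruhat u (v *m t).

(* The Bruhat order on W/W_J, on the cosets of u and v. *)
Definition bruhat_quot (J : set 'I_n) (u v : 'M[int]_n) : Prop :=
  exists u' v' x y,
    [/\ min_reps J u' /\ min_reps J v', parabolic_weyl J x, parabolic_weyl J y,
        u = u' *m x /\ v = v' *m y & bruhat u' v'].

(* I^w and I_w. *)
Definition Iup (w : 'M[int]_n) : set 'I_n :=
  [set i | pos_root (w *m simple_root i)].

Definition Ilow (w : 'M[int]_n) : set 'I_n :=
  [set i | bruhat_quot (Iup w) (srefl i *m w) w].

End Weyl.

(* The coroot of w(alpha_i) is w(alpha_i^vee), and W acts on the coroot lattice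
   through the transposed Cartan matrix.  [minuscule C i] says that
   <varpi_i, beta^vee> <= 1 for every positive root beta. *)
Definition coroot_of n (C : 'M[int]_n) (v c : 'cV[int]_n) : Prop :=
  exists s i, v = word C s *m simple_root i /\ c = word C^T s *m simple_root i.

Definition minuscule n (C : 'M[int]_n) (i : 'I_n) : Prop :=
  forall v c, pos_root C v -> coroot_of C v c -> c i 0 <= 1.

(** * The quiver of a reduced word and Construction 1 *)

Section Quiver.
Variables (n : nat) (C : 'M[int]_n) (rw : seq 'I_n).

Definition vlabel (v : 'I_(size rw)) : 'I_n := tnth (in_tuple rw) v.

(* The last conjunct says j < s(i) when the successor s(i) exists, and is
   void otherwise. *)
Definition arrow : rel 'I_(size rw) := fun i j =>
  [&& C (vlabel j) (vlabel i) != 0, (i < j)%N &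
      [forall l : 'I_(size rw),
         ((i < l)%N && (vlabel l == vlabel i)) ==> (j < l)%N]].

Definition preceq : rel 'I_(size rw) := connect arrow.

Definition peaks : {set 'I_(size rw)} :=
  [set p | [forall v, preceq v p ==> (v == p)]].

(* The sets V_1, ..., V_m; [used] is the union of the preceding ones. *)
Fixpoint blocks (used : {set 'I_(size rw)}) (ps : seq 'I_(size rw))
    : seq {set 'I_(size rw)} :=
  if ps is p :: ps' then
    let V := [set v | (v \notin used) && all (fun q => ~~ preceq q v) ps']%SET in
    V :: blocks (used :|: V)%SET ps'
  else [::].

(* [enum V] lists V in increasing order. *)
Definition construction1 (ps : seq 'I_(size rw)) : seq 'M[int]_n :=
  [seq word C [seq vlabel v | v <- enum (V : {set 'I_(size rw)})]
     | V <- blocks finset.set0 ps].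

End Quiver.

(** * Varieties as spaces with functions

   A variety over an algebraically closed field is given by its points, its
   open sets and, for each open set U, the functions regular on U.  Regular
   functions are total functions whose values off U are irrelevant. *)

Record space (K : Type) := Space {
  pt : Type;
  zopen : set (set pt);
  regular : set pt -> set (pt -> K) }.

Section Spaces.
Variable K : closedFieldType.
Implicit Types X : space K.

(* Affine space, as a type [A] with a finite family of coordinates. *)
Definition peval (A : Type) (I : finType) (x : A -> I -> K)
    (p : {mpoly K[#|I|]}) (a : A) : K := p.@[fun k => x a (enum_val k)].

Definition affine (A : Type) (I : finType) (x : A -> I -> K) : space K :=
  @Space K A
    [set U | exists S : set {mpoly K[#|I|]},
       U = [set a | exists2 p, S p & peval x p a != 0]]
    (fun U => [set f | forall a, U a -> exists p q, peval x q a != 0 /\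
       forall b, U b -> peval x q b != 0 -> f b = peval x p b / peval x q b]).

(* A locally closed subset with its reduced structure. *)
Definition subspace X (D : set (pt X)) : space K :=
  @Space K {a : pt X | D a}
    [set U | exists2 V, zopen V & U = [set a | V (sval a)]]
    (fun U => [set f | forall a, U a -> exists V g,
       [/\ zopen V, V (sval a), regular V g &
           forall b, U b -> V (sval b) -> f b = g (sval b)]]).

(* The quotient structure along a map q. *)
Definition quotient X (Q : Type) (q : pt X -> Q) : space K :=
  @Space K Q [set U | zopen (q @^-1` U)]
    (fun U => [set f | regular (q @^-1` U) (fun a => f (q a))]).

Definition zclosed X (Z : set (pt X)) : Prop := zopen (~` Z).

Definition zclosure X (Z : set (pt X)) : set (pt X) :=
  [set a | forall F, zclosed F -> Z `<=` F -> F a].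

Definition zirreducible X (Z : set (pt X)) : Prop :=
  Z !=set0 /\ forall F1 F2, zclosed F1 -> zclosed F2 -> Z `<=` F1 `|` F2 ->
    Z `<=` F1 \/ Z `<=` F2.

Definition zconnected X (Z : set (pt X)) : Prop :=
  forall F1 F2, zclosed F1 -> zclosed F2 -> Z `<=` F1 `|` F2 ->
    Z `&` F1 `&` F2 = set0 -> Z `<=` F1 \/ Z `<=` F2.

Definition irreducible_chain X (d : nat) : Prop :=
  exists Z : nat -> set (pt X),
    (forall k, (k <= d)%N -> zclosed (Z k) /\ zirreducible (Z k)) /\
    (forall k, (k < d)%N -> Z k `<=` Z k.+1 /\ ~ (Z k.+1 `<=` Z k)).

Definition dimension X (d : nat) : Prop :=
  irreducible_chain X d /\ ~ irreducible_chain X d.+1.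

(* The pair (U, f) represents a germ of regular function at a. *)
Definition germ X (a : pt X) (U : set (pt X)) (f : pt X -> K) : Prop :=
  [/\ zopen U, U a & regular U f].

(* K-linear derivations from the local ring at a to K. *)
Definition tangent X (a : pt X) (D : set (pt X) -> (pt X -> K) -> K) : Prop :=
  [/\ forall U V f g, germ a U f -> germ a V g ->
        (exists O, [/\ zopen O, O a, O `<=` U `&` V &
           forall b, O b -> f b = g b]) -> D U f = D V g,
      forall U (k : K) f g, germ a U f -> germ a U g ->
        D U (fun b => k * f b + g b) = k * D U f + D U g
    & forall U f g, germ a U f -> germ a U g ->
        D U (fun b => f b * g b) = f a * D U g + g a * D U f].

Definition tangent_dim X (a : pt X) (d : nat) : Prop :=
  exists E : 'I_d -> set (pt X) -> (pt X -> K) -> K,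
    (forall i, tangent a (E i)) /\
    forall D, tangent a D -> exists! c : 'rV[K]_d,
      forall U f, germ a U f -> D U f = \sum_i c 0 i * E i U f.

(* Smoothness, for equidimensional varieties. *)
Definition smooth X : Prop :=
  exists2 d, dimension X d & forall a : pt X, tangent_dim a d.

End Spaces.

(** * Linear algebraic groups, as subgroups of GL_N *)

Section Groups.
Variables (K : closedFieldType) (N : nat).
Notation M := 'M[K]_N.
Implicit Types (H : set M) (chi : M -> K).

Definition mat_coord (g : M) (ij : 'I_N * 'I_N) : K := g ij.1 ij.2.
Definition mat_space : space K := affine mat_coord.

Definition subgroup H : Prop :=
  [/\ H `<=` [set g | g \in unitmx], H 1%:M,
      forall g h, H g -> H h -> H (g *m h) & forall g, H g -> H (invmx g)].

Definition generated (A : set M) : set M :=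
  [set g | forall H, subgroup H -> A `<=` H -> H g].

Definition closed_subgroup H : Prop :=
  subgroup H /\ exists2 F : set M, @zclosed K mat_space F
    & H = F `&` [set g | g \in unitmx].

Definition connected_group H : Prop :=
  closed_subgroup H /\ @zconnected K mat_space H.

Definition normal_in H G : Prop :=
  H `<=` G /\ forall g h, G g -> H h -> H (g *m h *m invmx g).

Definition simple_group G : Prop :=
  [/\ connected_group G,
      exists g h, [/\ G g, G h & g *m h <> h *m g]
    & forall H, connected_group H -> normal_in H G -> H = [set 1%:M] \/ H = G].

Definition torus H : Prop :=
  connected_group H /\ exists2 p : M, p \in unitmx &
    forall t, H t -> is_diag_mx (p *m t *m invmx p).

Definition derived H : set M :=
  generated [set x | exists g h,
    [/\ H g, H h & x = g *m h *m invmx g *m invmx h]].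

Definition solvable_group H : Prop :=
  exists k, iter k derived H `<=` [set 1%:M].

Definition maximal_in (p : set M -> Prop) G H : Prop :=
  [/\ p H, H `<=` G & forall H', p H' -> H' `<=` G -> H `<=` H' -> H' = H].

Definition maximal_torus G T : Prop := maximal_in torus G T.

Definition borel G B : Prop :=
  maximal_in (fun H => connected_group H /\ solvable_group H) G B.

(* The tangent space at 1 of H, as a subspace of M. *)
Definition lie H : set M :=
  [set x | forall p : {mpoly K[#|{: 'I_N * 'I_N}|]},
     (forall h, H h -> peval mat_coord p h = 0) ->
     \sum_k peval mat_coord (mderiv k p) 1%:M * mat_coord x (enum_val k) = 0].

(* A character of T is given by a function on M, only its values on T matter. *)
Definition character (T : set M) chi : Prop :=
  [/\ @regular K (@subspace K mat_space T) setT (fun t => chi (sval t)),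
      chi 1%:M = 1
    & forall s t, T s -> T t -> chi (s *m t) = chi s * chi t].

(* The nonzero weights of T in Lie(H). *)
Definition weight_in (T H : set M) chi : Prop :=
  [/\ character T chi, exists2 t, T t & chi t <> 1
    & exists x, [/\ lie H x, x <> 0 &
        forall t, T t -> t *m x *m invmx t = chi t *: x]].

(* The simple roots of the positive system formed by the roots of B. *)
Definition simple_weight (T B : set M) chi : Prop :=
  weight_in T B chi /\
  ~ exists chi1 chi2, [/\ weight_in T B chi1, weight_in T B chi2 &
      forall t, T t -> chi t = chi1 t * chi2 t].

(* The root subgroup of a root chi is the image of an injective morphism x from
   the additive group with t x(a) t^-1 = x(chi(t) a).  Since the weight is chi
   and not one of its p-power multiples, x is an isomorphism onto its image. *)
Definition root_hom (G T : set M) chi (x : K -> M) : Prop :=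
  [/\ exists p : 'M[{poly K}]_N, forall a, x a = map_mx (fun q => q.[a]) p,
      forall a, G (x a),
      forall a b, x (a + b) = x a *m x b,
      injective x
    & forall t a, T t -> t *m x a *m invmx t = x (chi t * a)].

Definition root_subgroup (G T : set M) chi : set M :=
  [set g | exists x, root_hom G T chi x /\ exists a, g = x a].

(* The coroot of chi: the cocharacter of T with values in the group generated
   by the root subgroups of chi and its opposite, and with <chi, chi^vee> = 2. *)
Definition coroot (G T : set M) chi (la : K -> M) : Prop :=
  [/\ exists k (p : 'M[{poly K}]_N), forall a, a != 0 ->
        la a = a ^- k *: map_mx (fun q => q.[a]) p,
      forall a b, a != 0 -> b != 0 -> la (a * b) = la a *m la b,
      forall a, a != 0 -> T (la a) /\
        generated (root_subgroup G T chi `|`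
                   root_subgroup G T (fun t => (chi t)^-1)) (la a)
    & forall a, a != 0 -> chi (la a) = a ^+ 2].

(* G is a simply connected simple algebraic group, with maximal torus T and
   Borel subgroup B, whose simple roots are sr_1, ..., sr_n with Cartan matrix
   C.  Simple connectedness: the fundamental weights are characters of T. *)
Definition sc_simple_group n (C : 'M[int]_n) (G T B : set M)
    (sr : 'I_n -> M -> K) : Prop :=
  [/\ simple_group G, maximal_torus G T, borel G B, T `<=` B
    & [/\ forall i, simple_weight T B (sr i),
          forall chi, simple_weight T B chi ->
            exists i, forall t, T t -> chi t = sr i t
        & exists2 cr : 'I_n -> K -> M,
            forall i, coroot G T (sr i) (cr i) /\
              forall j a, a != 0 -> sr j (cr i a) = a ^ C i j
          & forall i, exists2 om, character T om &
              forall j a, a != 0 -> om (cr j a) = a ^+ (i == j)]].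

End Groups.

(** * Schubert varieties and the variety attached to a generalised reduced
      decomposition *)

Section Schubert.
Variables (K : closedFieldType) (N n : nat) (C : 'M[int]_n).
Variables (G T B : set 'M[K]_N) (sr : 'I_n -> 'M[K]_N -> K).
Notation M := 'M[K]_N.

(* g in N_G(T) represents w when chi(g^-1 t g) = (w chi)(t). *)
Definition represents (g : M) (w : 'M[int]_n) : Prop :=
  [/\ G g, forall t, T t <-> T (invmx g *m t *m g)
    & forall t i, T t ->
        sr i (invmx g *m t *m g) = \prod_j sr j t ^ w j i].

Definition parabolic (J : set 'I_n) : set M :=
  generated (B `|` [set g | exists2 i, J i & represents g (srefl C i)]).

Definition Pup (w : 'M[int]_n) : set M := parabolic (Iup C w).
Definition Plow (w : 'M[int]_n) : set M := parabolic (Ilow C w).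

Definition Gsub (w : 'M[int]_n) : set M :=
  generated [set g | exists2 i, supp C w i &
    root_subgroup G T (sr i) g \/
    root_subgroup G T (fun t => (sr i t)^-1) g].

Definition lcoset (g : M) (P : set M) : set M := [set g *m x | x in P].

(* G/P, its points being the cosets gP. *)
Definition flag (P : set M) : space K :=
  @quotient K (@subspace K (mat_space K N) G) (set M)
    (fun g => lcoset (sval g) P).

Definition schubert (w : 'M[int]_n) : set (set M) :=
  @zclosure K (flag (Pup w))
    [set x | exists b g, [/\ B b, represents g w & x = lcoset (b *m g) (Pup w)]].

(* The closure in G_w of (P_w cap G_w) w (P^w cap G_w). *)
Definition fibred_cell (w : 'M[int]_n) : set M :=
  Gsub w `&` @zclosure K (mat_space K N)
    [set x | exists p g q,
       [/\ Plow w p /\ Gsub w p, represents g w /\ Gsub w g,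
           Pup w q /\ Gsub w q & x = p *m g *m q]].

(* For a closed subgroup H of C and an H-stable subvariety Z of a G-variety F,
   the contracted product of C and Z over H embeds in C/H x F by
   [c, z] |-> (cH, c z).  The variety attached to (w_1, ..., w_m) is realised
   in this way in G/P^{w_1} x ... x G/P^{w_m}, on which G acts diagonally. *)
Fixpoint Xhat (ws : seq 'M[int]_n) : set (seq (set M)) :=
  match ws with
  | [::] => [set [::]]
  | [:: w] => [set [:: x] | x in schubert w]
  | w :: ws' => [set xs | exists c zs,
      [/\ fibred_cell w c, Xhat ws' zs
        & xs = lcoset c (Pup w) :: [seq lcoset c z | z <- zs]]]
  end.

Definition tuple_coord m (g : m.-tuple M) (k : 'I_m * ('I_N * 'I_N)) : K :=
  mat_coord (tnth g k.1) k.2.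

(* The product of the G/P_t, as the quotient of G^m by the product of the P_t. *)
Definition flag_product m (Ps : m.-tuple (set M)) : space K :=
  @quotient K
    (@subspace K (affine (@tuple_coord m)) [set g | forall t, G (tnth g t)])
    (m.-tuple (set M))
    (fun g => [tuple lcoset (tnth (sval g) t) (tnth Ps t) | t < m]).

Definition Xhat_space (ws : seq 'M[int]_n) : space K :=
  @subspace K (flag_product (map_tuple Pup (in_tuple ws)))
    [set x : (size ws).-tuple (set M) | Xhat ws x].

End Schubert.

(* Main.v *)
(* Let varpi be the minuscule weight at i0.  For a reduced word s_{x_1}...s_{x_k}
   of w, the weight s_{x_j}...s_{x_k}(varpi) pairs to -1 with alpha_{x_j}, and
   every weight of the orbit pairs with every root in {-1, 0, 1}.  Write
   w = w_1 u and g = - w_1^{-1}(alpha), so that u(varpi) pairs to 1 with g.  When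
   a weight pairs to 1 with a root g and to -1 with alpha_x, then (g, alpha_x) > 0
   would make its pairing with s_x(g) at least 2; hence s_x(g) >= g.  Applying the
   letters of u one after the other gives u^{-1}(g) >= g.

   In the same way g is built up from alpha through the heap of w_1, which has a
   single peak, so the support of g is Supp(w_1).  If u^{-1}(g) = g then g is
   orthogonal to Supp(u), so no letter of u outside Supp(w_1) is linked to
   Supp(w_1); the label of a second peak is such a letter.  So Supp(w) would be
   disconnected, and the last letter in the part avoiding i0 would fix varpi. *)
Require Import Defs.
From mathcomp Require Import all_boot all_order all_algebra.
From mathcomp Require Import boolp classical_sets.
From mathcomp Require Import zify ring.
Import Order.TTheory GRing.Theory Num.Theory.
Local Open Scope ring_scope.

Set Implicit Arguments.
Unset Strict Implicit.
Unset Printing Implicit Defensive.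

Definition nonneg n (v : 'cV[int]_n) : Prop := forall i, 0 <= v i 0.

(** * Simple reflections, words and the quadratic form *)

Section RootSystem.

Variables (n : nat) (C A : 'M[int]_n).
Hypothesis C_sym : C = A + A^T.
Hypothesis A_diag : forall i, A i i = 1.
Hypothesis C_off : forall i j, i != j -> C i j <= 0.

Definition qform (v : 'cV[int]_n) : int := (v^T *m A *m v) 0 0.

Hypothesis qform_gt0 : forall v, v != 0 -> 0 < qform v.

Local Notation alpha := (@simple_root n).
Local Notation s_ := (srefl C).
Local Notation word := (word C).
Implicit Types (a b i j x y : 'I_n) (s t l u : seq 'I_n) (v : 'cV[int]_n).

Let C_tr : C^T = C.
Proof. by rewrite C_sym linearD /= trmxK addrC. Qed.

Let C_symE i j : C i j = C j i.
Proof. by rewrite -[in RHS]C_tr mxE. Qed.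

Let C_diag i : C i i = 2.
Proof. by rewrite C_sym !mxE A_diag. Qed.

Lemma simple_rootE i j : alpha i j 0 = (j == i)%:R.
Proof. by rewrite mxE eqxx andbT. Qed.

Lemma mulmx_simple (M : 'M[int]_n) i j : (M *m alpha i) j 0 = M j i.
Proof.
rewrite mxE (bigD1 i) //= simple_rootE eqxx mulr1 big1 ?addr0 // => k ki.
by rewrite simple_rootE (negPf ki) mulr0.
Qed.

Lemma vec_sum_simple v : v = \sum_i v i 0 *: alpha i.
Proof.
apply/matrixP => i j; rewrite ord1 summxE (bigD1 i) //= mxE simple_rootE eqxx.
rewrite mulr1 big1 ?addr0 // => k ki.
by rewrite mxE simple_rootE eq_sym (negPf ki) mulr0.
Qed.

Lemma sreflE i : s_ i = 1%:M - alpha i *m ((alpha i)^T *m C).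
Proof. by rewrite mulmxA trmx_delta mul_delta_mx. Qed.

Lemma srefl_mulv i v : s_ i *m v = v - (C *m v) i 0 *: alpha i.
Proof.
rewrite mulmxBl mul1mx -mulmxA; congr (_ - _); apply/matrixP => j k.
rewrite ord1 mxE (bigD1 i) //= big1 ?addr0; last first.
  by move=> l li; rewrite mxE (negPf li) andbF mul0r.
by rewrite !mxE !eqxx !andbT mulrC.
Qed.

Lemma srefl_coord i v j : (s_ i *m v) j 0 = v j 0 - (C *m v) i 0 * (j == i)%:R.
Proof. by rewrite srefl_mulv !mxE eqxx andbT. Qed.

Lemma srefl_coord_neq i v j : j != i -> (s_ i *m v) j 0 = v j 0.
Proof. by move=> /negPf ji; rewrite srefl_coord ji mulr0 subr0. Qed.

Lemma srefl_simple x y : s_ x *m alpha y = alpha y - C x y *: alpha x.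
Proof. by rewrite srefl_mulv mulmx_simple. Qed.

Lemma srefl_simple_id x : s_ x *m alpha x = - alpha x.
Proof. by rewrite srefl_simple C_diag scaler_nat mulr2n opprD addrA subrr add0r. Qed.

Lemma sreflK x : s_ x *m s_ x = 1%:M.
Proof.
rewrite [in X in _ *m X]/srefl mulmxBr mulmx1 mulmxA.
have -> : s_ x *m delta_mx x x = - delta_mx x x.
  by rewrite -(mul_delta_mx (0 : 'I_1) x x) mulmxA srefl_simple_id mulNmx.
by rewrite mulNmx opprK /srefl subrK.
Qed.

Lemma mulmx_inj (M N : 'M[int]_n) : (forall v, M *m v = N *m v) -> M = N.
Proof. by move=> MN; apply/matrixP => i j; rewrite -!mulmx_simple MN. Qed.

Lemma srefl_mulvB x v k y :
  s_ x *m (v - k *: alpha y) = s_ x *m v - k *: (s_ x *m alpha y).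
Proof. by rewrite mulmxBr scalemxAr. Qed.

Lemma srefl_fix x y : C x y = 0 -> s_ x *m alpha y = alpha y.
Proof. by rewrite srefl_simple => ->; rewrite scale0r subr0. Qed.

Lemma srefl_comm x y : C x y = 0 -> s_ x *m s_ y = s_ y *m s_ x.
Proof.
move=> xy; apply: mulmx_inj => v; rewrite -!mulmxA.
rewrite [s_ y *m v]srefl_mulv [s_ x *m v]srefl_mulv !srefl_mulvB.
by rewrite !srefl_fix // 1?C_symE // !srefl_mulv addrAC.
Qed.

Lemma word_cat s t : word (s ++ t) = word s *m word t.
Proof. by elim: s => [|x s IH] /=; rewrite ?mul1mx // IH mulmxA. Qed.

Lemma word_rcons s x : word (rcons s x) = word s *m s_ x.
Proof. by rewrite -cats1 word_cat /= mulmx1. Qed.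

Lemma word_revK s : word (rev s) *m word s = 1%:M.
Proof.
elim: s => [|x s IH]; first by rewrite mulmx1.
by rewrite rev_cons word_rcons /= mulmxA -(mulmxA _ (s_ x) (s_ x)) sreflK mulmx1.
Qed.

Lemma word_Krev s : word s *m word (rev s) = 1%:M.
Proof. by rewrite -{1}(revK s) word_revK. Qed.

Lemma invmx_word s : invmx (word s) = word (rev s).
Proof.
have [_ u] := mulmx1_unit (word_revK s).
by rewrite -[LHS]mul1mx -(word_revK s) mulmxK.
Qed.

Lemma is_root_simple i : is_root C (alpha i).
Proof. by exists [::], i; rewrite mul1mx. Qed.

Lemma is_root_word s v : is_root C v -> is_root C (word s *m v).
Proof. by move=> [t [i ->]]; exists (s ++ t), i; rewrite word_cat mulmxA. Qed.

Lemma is_root_srefl x v : is_root C v -> is_root C (s_ x *m v).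
Proof. by move=> /(is_root_word [:: x]); rewrite /= mulmx1. Qed.

Lemma is_rootN v : is_root C v -> is_root C (- v).
Proof.
move=> [t [i ->]]; exists (rcons t i), i.
by rewrite word_rcons -mulmxA srefl_simple_id mulmxN.
Qed.

Lemma qform_simple i : qform (alpha i) = 1.
Proof. by rewrite /qform trmx_delta -mulmxA -rowE mxE mulmx_simple A_diag. Qed.

Lemma qformD v w : qform (v + w) = qform v + qform w + (v^T *m C *m w) 0 0.
Proof.
have -> : (v^T *m C *m w) 0 0 = (v^T *m A *m w) 0 0 + (w^T *m A *m v) 0 0.
  have -> : (w^T *m A *m v) 0 0 = (w^T *m A *m v)^T 0 0 by rewrite [RHS]mxE.
  by rewrite !trmx_mul trmxK mulmxA C_sym mulmxDr mulmxDl [LHS]mxE.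
by rewrite /qform [(v + w)^T]linearD /= !mulmxDl !mulmxDr !mxE; ring.
Qed.

Lemma qformZ k v : qform (k *: v) = k ^+ 2 * qform v.
Proof.
by rewrite /qform [(k *: v)^T]linearZ /= -!scalemxAl -scalemxAr !mxE mulrA expr2.
Qed.

Lemma qform_srefl x v : qform (s_ x *m v) = qform v.
Proof.
rewrite srefl_mulv -scaleNr addrC qformD qformZ qform_simple.
have -> : ((- (C *m v) x 0 *: alpha x)^T *m C *m v) 0 0 = - (C *m v) x 0 ^+ 2.
  rewrite [(_ *: _)^T]linearZ /= -!scalemxAl -mulmxA trmx_delta -rowE !mxE; ring.
by rewrite sqrrN mulr1 addrAC subrr add0r.
Qed.

Lemma qform_root v : is_root C v -> qform v = 1.
Proof.
move=> [s [i ->]]; elim: s => [|x s IH]; first by rewrite mul1mx qform_simple.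
by rewrite -mulmxA qform_srefl.
Qed.

Lemma root_neq0 v : is_root C v -> v != 0.
Proof.
move=> /qform_root v1; apply/eqP => v0; move: v1.
by rewrite v0 /qform mulmx0 mxE.
Qed.

(* A root of mixed sign v = p - m would satisfy
   q(v) = q(p) + q(m) - (p, m) >= 2. *)
Lemma root_sign v : is_root C v -> nonneg v \/ nonneg (- v).
Proof.
move=> /qform_root qv.
pose p : 'cV[int]_n := \col_i Num.max (v i 0) 0.
pose m : 'cV[int]_n := \col_i Num.min (v i 0) 0.
have vpm : v = p + m.
  by apply/matrixP => i j; rewrite ord1 !mxE addr_max_min addr0.
have pm : 0 <= (p^T *m C *m m) 0 0.
  rewrite mxE; apply: sumr_ge0 => j _; rewrite mxE mulr_suml.
  apply: sumr_ge0 => i _; rewrite !mxE; case: (eqVneq i j) => [->|ij].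
    by case: (leP (v j 0) 0) => _; rewrite ?mul0r ?mulr0.
  rewrite -mulrA mulr_ge0 ?le_max ?lexx ?orbT // mulr_le0 ?C_off //.
  by rewrite ge_min lexx orbT.
case: (eqVneq p 0) => [p0|p0].
  right=> i; rewrite mxE oppr_ge0; have /matrixP/(_ i 0) := p0; rewrite !mxE => <-.
  by rewrite le_max lexx.
case: (eqVneq m 0) => [m0|m0].
  left=> i; have /matrixP/(_ i 0) := m0; rewrite !mxE => <-.
  by rewrite ge_min lexx.
have := qform_gt0 p0; have := qform_gt0 m0; move: qv; rewrite vpm qformD.
lia.
Qed.

Lemma simple_nonneg i : nonneg (alpha i).
Proof. by move=> j; rewrite simple_rootE. Qed.

Lemma nonneg_anti v : is_root C v -> nonneg v -> nonneg (- v) -> False.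
Proof.
move=> /root_neq0/eqP + v0 v0'; apply; apply/matrixP => i j; rewrite ord1 mxE.
by apply: le_anti; rewrite v0 -oppr_ge0; have := v0' i; rewrite mxE => ->.
Qed.

(** Only the [x]-coordinate changes under [s_ x], so a sign change confines [v] to the line of
    [alpha x], and [qform v = 1] fixes the multiple. *)
Lemma nonneg_srefl x v :
  is_root C v -> nonneg v -> ~ nonneg (s_ x *m v) -> v = alpha x.
Proof.
move=> rv v0; have [//|sv0 _] := root_sign (is_root_srefl x rv).
have vE : v = v x 0 *: alpha x.
  rewrite {1}[v]vec_sum_simple (bigD1 x) //= big1 ?addr0 // => j jx.
  have := sv0 j; rewrite mxE srefl_coord_neq // oppr_ge0 => vj.
  by rewrite (_ : v j 0 = 0) ?scale0r //; apply: le_anti; rewrite vj v0.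
have /eqP := qform_root rv; rewrite vE qformZ qform_simple mulr1 => /eqP vx.
suff -> : v x 0 = 1 by rewrite scale1r.
by have := v0 x; move: vx; rewrite expr2; nia.
Qed.

(** * The invariant form, exchange and reduced words *)

Lemma word_isometry s : (word s)^T *m C *m word s = C.
Proof.
have aux x : (s_ x)^T *m C *m s_ x = C.
  have sC : (s_ x)^T *m C = C *m s_ x.
    rewrite linearB /= trmx1 mulmxBl mul1mx mulmxBr mulmx1; congr (_ - _).
    by rewrite trmx_mul trmx_delta C_tr mulmxA.
  by rewrite sC -mulmxA sreflK mulmx1.
elim: s => [|x s IH] /=; first by rewrite trmx1 mul1mx mulmx1.
rewrite trmx_mul -!mulmxA [(s_ x)^T *m _]mulmxA mulmxA mulmxA.
by rewrite -(mulmxA _ _ (s_ x)) aux.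
Qed.

Lemma srefl_conj s x y : word s *m alpha x = alpha y ->
  s_ y *m word s = word s *m s_ x.
Proof.
move=> sxy; rewrite !sreflE mulmxBl mulmxBr mul1mx mulmx1; congr (_ - _).
have -> : alpha x *m ((alpha x)^T *m C) =
    alpha x *m ((alpha x)^T *m ((word s)^T *m C *m word s)).
  by rewrite word_isometry.
by rewrite -sxy trmx_mul !mulmxA.
Qed.

(** At the letter [y] that turns the image of [alpha x] negative, this image was [alpha y];
    conjugation then turns [s_ x] into [s_ y], which cancels the letter. *)
Lemma exchange s x : ~ nonneg (word s *m alpha x) ->
  exists2 t, (size t < size s)%N & word s *m s_ x = word t.
Proof.
elim: s => [|y s IH] /=; first by rewrite mul1mx => /(_ (simple_nonneg x)).
rewrite -mulmxA => nyx; case: (pselect (nonneg (word s *m alpha x))) => [sx|/IH].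
  exists s => //; have rx := is_root_word s (is_root_simple x).
  have /srefl_conj ys := nonneg_srefl rx sx nyx.
  by rewrite ys -mulmxA sreflK mulmx1.
by move=> [t lt st]; exists (y :: t); rewrite //= -st mulmxA.
Qed.

Lemma reduced_left s x t : reduced C (s ++ x :: t) -> nonneg (word s *m alpha x).
Proof.
move=> red; apply: contrapT => /exchange [r lt sr].
have /red : word (r ++ t) = word (s ++ x :: t) by rewrite !word_cat /= -sr mulmxA.
by rewrite !size_cat /=; lia.
Qed.

Lemma reduced_right s x t :
  reduced C (s ++ x :: t) -> nonneg (word (rev t) *m alpha x).
Proof.
move=> red; apply: contrapT => /exchange [r lt sr].
have xt : word (rev r) = word (x :: t).
  rewrite -[LHS]mul1mx -(word_Krev (x :: t)) rev_cons word_rcons sr.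
  by rewrite -mulmxA word_Krev mulmx1.
have /red : word (s ++ rev r) = word (s ++ x :: t) by rewrite !word_cat xt.
by rewrite !size_cat /= size_rev; move: lt; rewrite size_rev; lia.
Qed.

(** * Minuscule words and their action on roots *)

Variable i0 : 'I_n.
Hypothesis coef_le1 : forall v, is_root C v -> v i0 0 <= 1.

(* [act s] is the action of the inverse of [word s]. *)
Definition act s v : 'cV[int]_n := word (rev s) *m v.

(* For w = s_{x_1} ... s_{x_k}: each weight s_{x_{j+1}} ... s_{x_k}(varpi_{i0})
   pairs to 1 with alpha_{x_j}.  Indeed the pairing of word(u)(varpi_{i0}) with b
   is that of varpi_{i0} with [act u b], which is an i0-coordinate. *)
Definition minuscule_word s : Prop :=
  forall t x u, s = t ++ x :: u -> act u (alpha x) i0 0 = 1.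

Lemma act_cons x s v : act (x :: s) v = act s (s_ x *m v).
Proof. by rewrite /act rev_cons word_rcons mulmxA. Qed.

Lemma act_nil v : act [::] v = v.
Proof. exact: mul1mx. Qed.

Lemma act_cat s t v : act (s ++ t) v = act t (act s v).
Proof. by rewrite /act rev_cat word_cat mulmxA. Qed.

Lemma act_rcons s x v : act (rcons s x) v = s_ x *m act s v.
Proof. by rewrite -cats1 act_cat act_cons act_nil. Qed.

Lemma actN s v : act s (- v) = - act s v.
Proof. exact: mulmxN. Qed.

Lemma is_root_act s v : is_root C v -> is_root C (act s v).
Proof. exact: is_root_word. Qed.

Lemma coef_geN1 v : is_root C v -> -1 <= v i0 0.
Proof. by move=> /is_rootN/coef_le1; rewrite mxE lerNl. Qed.

Lemma act_step x s v :
  act (x :: s) v i0 0 = act s v i0 0 - (C *m v) x 0 * act s (alpha x) i0 0.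
Proof. by rewrite act_cons srefl_mulv /act mulmxBr -scalemxAr !mxE. Qed.

Lemma act_fix s x : (forall y, y \in s -> C y x = 0) -> act s (alpha x) = alpha x.
Proof.
elim: s => [|y s IH] ys; first by rewrite act_nil.
rewrite act_cons srefl_fix ?ys ?mem_head // IH // => z zs.
by rewrite ys // inE zs orbT.
Qed.

Lemma act_notin s v j : j \notin s -> act s v j 0 = v j 0.
Proof.
elim: s v => [|y s IH] v; first by rewrite act_nil.
by rewrite inE negb_or act_cons => /andP[jy js]; rewrite IH // srefl_coord_neq.
Qed.

Lemma minuscule_word_suffix s t : minuscule_word (s ++ t) -> minuscule_word t.
Proof. by move=> m r x u tE; apply: (m (s ++ r)); rewrite tE catA. Qed.

Lemma minuscule_word_behead x s : minuscule_word (x :: s) -> minuscule_word s.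
Proof. exact: (@minuscule_word_suffix [:: x]). Qed.

Lemma minuscule_word_head x s : minuscule_word (x :: s) -> act s (alpha x) i0 0 = 1.
Proof. by move=> /(_ [::] x s erefl). Qed.

(** The root [act u (alpha x)] is positive and [word s] makes it negative. With [i0]-coordinate 0 it
    would be a nonnegative combination of simple roots that [word s] keeps nonnegative. *)
Lemma reduced_minuscule_word s : reduced C s ->
  (forall i, i != i0 -> nonneg (word s *m alpha i)) -> minuscule_word s.
Proof.
move=> red pos t x u sE; rewrite /act; set b := _ *m _.
have rb : is_root C b by apply/is_root_word/is_root_simple.
rewrite sE in red pos *; have b0 : nonneg b := reduced_right red.
have nb : nonneg (- (word (t ++ x :: u) *m b)).
  rewrite /b word_cat /= mulmxA -[in X in X *m _]mulmxA -[in X in X *m _]mulmxA.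
  rewrite word_Krev mulmx1 -mulmxA srefl_simple_id mulmxN opprK.
  exact: reduced_left red.
apply: le_anti; rewrite coef_le1 //= -gtz0_ge1 lt_def b0 andbT.
apply/eqP => bi0; apply: (nonneg_anti (is_root_word (t ++ x :: u) rb)) nb.
rewrite [b]vec_sum_simple mulmx_sumr => j; rewrite summxE; apply: sumr_ge0 => i _.
rewrite -scalemxAr mxE; case: (eqVneq i i0) => [->|ii0]; first by rewrite bi0 mul0r.
by rewrite mulr_ge0 ?pos.
Qed.

(* Otherwise s_x(v) would be a root of i0-coordinate at least 2 after [act s]. *)
Lemma ascent_step x s v : is_root C v -> minuscule_word (x :: s) ->
  act (x :: s) v i0 0 = 1 -> (C *m v) x 0 <= 0.
Proof.
move=> rv m; rewrite act_step (minuscule_word_head m) mulr1.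
by have := coef_le1 (is_root_act s rv); lia.
Qed.

(** By [ascent_step] each letter of [s] adds a nonnegative multiple of a simple root. The tail [t]
    makes the claim available for prefixes. *)
Lemma act_ge s t v : is_root C v -> minuscule_word (s ++ t) ->
  act (s ++ t) v i0 0 = 1 -> root_ge (act s v) v.
Proof.
elim: s v => [|x s IH] v rv m v1 j; first by rewrite act_nil.
have xv := ascent_step rv m v1.
rewrite act_cons; move: v1; rewrite cat_cons act_cons => v1.
have := IH _ (is_root_srefl x rv) (minuscule_word_behead m) v1 j.
by apply: le_trans; rewrite srefl_coord; case: eqP => _; rewrite ?mulr1 ?mulr0; lia.
Qed.

(** By [act_ge] the roots met along [s] only grow; as the last equals the first, every reflection is
    trivial. *)
Lemma act_eq s v : is_root C v -> minuscule_word s -> act s v i0 0 = 1 ->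
  act s v = v -> forall c, c \in s -> (C *m v) c 0 = 0.
Proof.
elim: s => [|x s IH] // rv m v1 vE c.
have xv := ascent_step rv m v1.
have rxv := is_root_srefl x rv; have m' := minuscule_word_behead m.
have Cx : (C *m v) x 0 = 0.
  have : root_ge (act s (s_ x *m v)) (s_ x *m v).
    by have := @act_ge s [::] _ rxv; rewrite cats0; apply=> //; rewrite -act_cons.
  by move=> /(_ x); rewrite -act_cons vE srefl_coord eqxx mulr1; lia.
rewrite inE => /predU1P[->//|]; apply: IH => //.
  by move: v1; rewrite act_cons srefl_mulv Cx scale0r subr0.
by move: vE; rewrite act_cons srefl_mulv Cx scale0r subr0.
Qed.

(* Every letter but the first is linked to an earlier one: the heap of [l] has
   the first letter as its only minimal element. *)
Definition one_peak l : Prop :=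
  forall t x u, l = t ++ x :: u -> t != [::] -> exists2 z, z \in t & C z x != 0.

(** A letter whose coordinate is still 0 has, by [one_peak], a neighbour already in the support. Its
    pairing with the root is then negative, and the reflection makes the coordinate positive. *)
Lemma act_support a s t : one_peak (a :: s) -> minuscule_word (s ++ t) ->
  act (s ++ t) (alpha a) i0 0 = 1 ->
  forall d, d \in a :: s -> 0 < act s (alpha a) d 0.
Proof.
have ra := is_root_simple a.
elim/last_ind: s t => [|s x IH] t opk m a1 d.
  by rewrite inE => /eqP ->; rewrite act_nil simple_rootE eqxx.
rewrite cat_rcons in m a1.
have {}IH : forall d, d \in a :: s -> 0 < act s (alpha a) d 0.
  apply: (IH (x :: t)) => // r y u sE; apply: (opk r y (rcons u x)).
  by rewrite -rcons_cons sE rcons_cat.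
have g0 : nonneg (act s (alpha a)).
  by move=> j; apply: le_trans (act_ge ra m a1 j); apply: simple_nonneg.
have xs : (C *m act s (alpha a)) x 0 <= 0.
  apply: (ascent_step (is_root_act s ra) (minuscule_word_suffix m)).
  by rewrite -act_cat.
rewrite act_rcons srefl_coord -rcons_cons mem_rcons inE.
have [->{d} _|dx /= /IH ds] := eqVneq d x; last by rewrite mulr0 subr0.
rewrite mulr1; have [x0|] := eqVneq (act s (alpha a) x 0) 0; last first.
  by have := g0 x; lia.
rewrite x0 sub0r oppr_gt0 lt_neqAle xs andbT; apply/eqP => /eqP.
have [z zs Czx] := opk (a :: s) x [::] (congr1 (cons a) (esym (cats1 s x))) isT.
rewrite mxE -oppr_eq0 -sumrN psumr_eq0 => [|j _].
  apply/negP; rewrite -has_predC; apply/hasP; exists z; first by rewrite mem_index_enum.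
  by rewrite /= oppr_eq0 mulf_neq0 // ?(C_symE x) // gt_eqF // IH.
have [->|jx] := eqVneq j x; first by rewrite x0 mulr0 oppr0.
by rewrite -mulNr mulr_ge0 // oppr_ge0 C_off // eq_sym.
Qed.

(** A nonnegative root can turn negative only at [v = alpha x], and then the rest of the word takes
    it to [i0]-coordinate -1. *)
Lemma act_nonneg s t v : is_root C v -> nonneg v -> minuscule_word (s ++ t) ->
  0 <= act (s ++ t) v i0 0 -> nonneg (act s v).
Proof.
elim: s v => [|x s IH] v rv v0 m p; first by rewrite act_nil.
rewrite act_cons; apply: IH; first exact: is_root_srefl.
- apply: contrapT => /(nonneg_srefl rv v0) vx; move: p.
  by rewrite vx act_cons srefl_simple_id actN mxE (minuscule_word_head m).
- exact: minuscule_word_behead m.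
- by rewrite -act_cons.
Qed.

(** Before the first [a], a letter linked to [a] would force the remaining word to take [alpha a] to
    [i0]-coordinate at most -2. *)
Lemma descent_letter s a : minuscule_word s -> act s (alpha a) i0 0 = -1 ->
  exists t u, s = t ++ a :: u /\ forall x, x \in t -> C x a = 0.
Proof.
elim: s => [|x s IH] m a1; first by move: a1; rewrite act_nil simple_rootE; case: eqP.
have [<-|xa] := eqVneq x a; first by exists [::], s.
have Cxa := C_off xa.
have Cxa0 : C x a = 0.
  move: a1; rewrite act_step mulmx_simple (minuscule_word_head m).
  by have := coef_geN1 (is_root_act s (is_root_simple a)); lia.
have [||t [u [-> tC]]] := IH; first exact: minuscule_word_behead m.
  by move: a1; rewrite act_cons srefl_fix.
by exists (x :: t), u; split=> // y; rewrite inE => /predU1P[->|/tC].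
Qed.

(* The last letter of [s] in [D] would commute with all letters after it. *)
Lemma minuscule_word_connected s (D : pred 'I_n) : minuscule_word s -> ~~ D i0 ->
  (forall x y, x \in s -> y \in s -> D x -> ~~ D y -> C x y = 0) ->
  forall x, x \in s -> ~~ D x.
Proof.
move=> + Di0; elim: s => [|z s IH] m sep x //.
have {}IH : forall y, y \in s -> ~~ D y.
  apply: IH (minuscule_word_behead m) _ => y w ys ws.
  by apply: sep; rewrite inE ?ys ?ws orbT.
rewrite inE => /predU1P[->{x}|/IH //]; apply/negP => Dz.
have := minuscule_word_head m; rewrite act_fix => [|y ys].
  by rewrite simple_rootE; case: eqP Dz Di0 => // -> ->.
by rewrite C_symE; apply: sep (IH _ ys); rewrite ?mem_head // inE ys orbT.
Qed.

(** * Comparison of the roots given by a word and its one-peak prefix *)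

(** Unless the [i0]-coordinate is -1, [act_nonneg] keeps [act l (alpha a)] nonnegative. So
    [descent_letter] finds an [a] preceded only by letters orthogonal to it; it lies in [l], as
    otherwise [l] fixes [alpha a], and [one_peak] puts it first. *)
Lemma neg_first_letter l u a : minuscule_word (l ++ u) -> one_peak l ->
  nonneg (- act l (alpha a)) ->
  exists2 s, l = a :: s & act (l ++ u) (alpha a) i0 0 = -1.
Proof.
move=> m opk neg; have ra := is_root_simple a.
have a1 : act (l ++ u) (alpha a) i0 0 = -1.
  have := coef_geN1 (is_root_act (l ++ u) ra); rewrite le_eqVlt => /predU1P[//|a0].
  case: (nonneg_anti (is_root_act l ra) _ neg).
  by apply: act_nonneg m _ => //; apply: simple_nonneg.
have [t [r [luE tC]]] := descent_letter m a1.
have [lt|tl] := leqP (size l) (size t).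
  have tE : take (size l) t = l.
    by have := take_size_cat u (erefl (size l)); rewrite luE takel_cat.
  case: (nonneg_anti ra (@simple_nonneg a)).
  rewrite -(@act_fix l) // => x xl; apply: tC; apply: (@mem_take (size l)).
  by rewrite tE.
have [s lE] : exists s, l = t ++ a :: s.
  exists (drop (size t).+1 l).
  rewrite -{1}(cat_take_drop (size t) l) (drop_nth a) //; congr (_ ++ _ :: _).
    by have := take_size_cat (a :: r) (erefl (size t)); rewrite -luE takel_cat // ltnW.
  have -> : nth a l (size t) = nth a (l ++ u) (size t) by rewrite nth_cat tl.
  by rewrite luE nth_cat ltnn subnn.
case: (eqVneq t [::]) lE => [-> lE|t0 lE]; first by exists s.
by have [z /tC -> /eqP] := opk _ _ _ lE t0.
Qed.

Lemma root_comparison l u a : minuscule_word (l ++ u) -> one_peak l ->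
  nonneg (- act l (alpha a)) ->
  root_ge (act l (alpha a)) (act (l ++ u) (alpha a)).
Proof.
move=> m opk neg; have [s lE lu1] := neg_first_letter m opk neg.
have ra := is_root_act l (is_root_simple a).
have u1 : act u (- act l (alpha a)) i0 0 = 1 by rewrite actN -act_cat mxE lu1 opprK.
have := @act_ge u [::] _ (is_rootN ra); rewrite cats0.
move=> /(_ (minuscule_word_suffix m) u1) ge j.
by have := ge j; rewrite actN -act_cat !mxE lerN2.
Qed.

Lemma root_comparison_strict l u a b : minuscule_word (l ++ u) -> one_peak l ->
  nonneg (- act l (alpha a)) -> b \in u -> b \notin l ->
  act l (alpha a) <> act (l ++ u) (alpha a).
Proof.
move=> m opk neg bu bl E; have [s lE lu1] := neg_first_letter m opk neg.
have ra := is_root_act l (is_root_simple a).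
pose g := act s (alpha a).
have gE : act l (alpha a) = - g by rewrite lE act_cons srefl_simple_id actN.
have rg : is_root C g by apply/is_root_act/is_root_simple.
have mu := minuscule_word_suffix m.
have lug : act (l ++ u) (alpha a) = - act u g by rewrite act_cat gE actN.
have u1 : act u g i0 0 = 1 by apply: oppr_inj; rewrite -lu1 lug [RHS]mxE.
have ug : act u g = g by apply: oppr_inj; rewrite -lug -E.
have Cg := act_eq rg mu u1 ug.
have gpos : forall d, d \in l -> 0 < g d 0.
  rewrite lE; apply: (@act_support _ _ u); first by rewrite -lE.
    by move: m; rewrite lE => /minuscule_word_behead.
  by rewrite act_cat.
have gnull d : d \notin l -> g d 0 = 0.
  move=> dl; have := act_notin (alpha a) dl; rewrite gE mxE simple_rootE.
  by case: eqP dl => [->|_ _ /eqP]; [rewrite lE mem_head | rewrite oppr_eq0 => /eqP].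
(* The pairing of [g] with [alpha x] is a sum of nonpositive terms over the support [l] of [g]; its
   vanishing kills every [C x y]. *)
have sep x y : x \in l ++ u -> x \notin l -> y \in l -> C x y = 0.
  rewrite mem_cat => /orP[->//|xu] xl yl; have /eqP := Cg _ xu.
  rewrite mxE -oppr_eq0 -sumrN psumr_eq0 => [/allP/(_ y)|j _].
    rewrite mem_index_enum => /(_ isT); rewrite oppr_eq0 mulf_eq0 => /orP[/eqP //|].
    by rewrite gt_eqF ?gpos.
  have [<-|xj] := eqVneq x j; first by rewrite gnull // mulr0 oppr0.
  rewrite -mulNr mulr_ge0 ?oppr_ge0 ?C_off //.
  by case: (boolP (j \in l)) => [/gpos/ltW|/gnull ->].
have al : a \in l by rewrite lE mem_head.
(* Connectedness is applied to whichever of [l] and its complement avoids [i0]: the former contains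
   [a], the latter [b]. *)
case: (boolP (i0 \in l)) => i0l.
  suff /(_ b) : forall x, x \in l ++ u -> ~~ predC (mem l) x.
    by rewrite mem_cat bu orbT /= bl => /(_ isT).
  apply: minuscule_word_connected m _ _ => /=; first by rewrite i0l.
  by move=> x y xs _ xl; rewrite negbK; apply: sep.
suff /(_ a) : forall x, x \in l ++ u -> ~~ mem l x.
  by rewrite mem_cat al => /(_ isT) /negP.
apply: minuscule_word_connected m _ _ => //= x y _ ys xl yl.
by rewrite C_symE; apply: sep.
Qed.

(** * Repeated letters and rearrangement of words *)

(** Otherwise [u] fixes [alpha x], the second [x] negates it, and its [i0]-coordinate ends at -1
    instead of 1. *)
Lemma minuscule_word_repeat t x u r : minuscule_word (t ++ x :: u ++ x :: r) ->
  exists2 y, y \in u & C y x != 0.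
Proof.
move=> m; apply: contrapT => nex; have := m t x (u ++ x :: r) erefl.
have m' : minuscule_word (x :: r).
  by apply: (@minuscule_word_suffix (t ++ x :: u)); rewrite -catA.
rewrite act_cat act_fix => [|y yu]; last first.
  by apply: contrapT => /eqP yx; apply: nex; exists y.
by rewrite act_cons srefl_simple_id actN mxE (minuscule_word_head m').
Qed.

(** A letter outside [P] commutes with every later letter in [P], so it can be moved to the right
    past all of them. *)
Lemma word_partition (T : eqType) (f : T -> 'I_n) (P : pred T) (e : seq T) :
  pairwise (fun k m => ~~ P k && P m ==> (C (f k) (f m) == 0)) e ->
  word (map f e) = word (map f (filter P e) ++ map f (filter (predC P) e)).
Proof.
elim: e => [|z e IH] //= /andP[/allP ze /IH ->]; case: ifP => //= /negbT nPz.
rewrite !word_cat mulmxA /= mulmxA; congr (_ *m _).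
have : forall k, k \in filter P e -> C (f z) (f k) = 0.
  by move=> k; rewrite mem_filter => /andP[Pk /ze]; rewrite nPz Pk => /eqP.
elim: (filter P e) => [|m s IHs] zs /=; first by rewrite mulmx1 mul1mx.
rewrite mulmxA srefl_comm ?zs ?mem_head // -!mulmxA IHs // => k ks.
by rewrite zs // inE ks orbT.
Qed.

End RootSystem.

(** * The order of the quiver and the first block of Construction 1 *)

Section Quiver.

Variables (n : nat) (C : 'M[int]_n) (rw : seq 'I_n).
Hypothesis C_symE : forall i j, C i j = C j i.
Hypothesis C_diag : forall i, C i i != 0.
Hypothesis repeat_linked : forall t x u r, rw = t ++ x :: u ++ x :: r ->
  exists2 y, y \in u & C y x != 0.

Local Notation lab := (@vlabel n rw).
Local Notation preceq := (@preceq n C rw).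
Implicit Types (i j k v p q : 'I_(size rw)).

Lemma preceq_leq i j : preceq i j -> (i <= j)%N.
Proof.
move=> /connectP[s + ->]; elim: s i => [|k s IH] i //= /andP[/and3P[_ ik _] /IH].
exact/leq_trans/ltnW.
Qed.

Lemma vlabelE i x : lab i = nth x rw i.
Proof. exact: tnth_nth. Qed.

Lemma repeat_linked_vertex i j : (i < j)%N -> lab i = lab j ->
  exists2 k : 'I_(size rw), (i < k < j)%N & C (lab k) (lab i) != 0.
Proof.
move=> ij labE; pose x := lab i.
pose u := take (j - i.+1) (drop i.+1 rw).
have rwE : rw = take i rw ++ x :: u ++ x :: drop j.+1 rw.
  rewrite -{1}(cat_take_drop i rw) (drop_nth x) // -vlabelE; congr (_ ++ _ :: _).
  rewrite -{1}(cat_take_drop (j - i.+1) (drop i.+1 rw)) drop_drop subnK //.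
  by rewrite (drop_nth x (ltn_ord j)) -vlabelE -labE.
have [y /(nthP x)[m mu <-] Cy] := repeat_linked rwE.
have mji : (m < j - i.+1)%N.
  by apply: leq_trans mu _; rewrite size_take; case: ltnP => // /ltnW.
have kj : (i.+1 + m < j)%N by lia.
exists (Ordinal (ltn_trans kj (ltn_ord j))); first by rewrite /= kj andbT; lia.
by move: Cy; rewrite nth_take // nth_drop (vlabelE (Ordinal _) x).
Qed.

(** If the label of [i] recurs before [j], the induction on the distance splits there. If not, there
    is an arrow unless both labels agree, and then the path passes through a linked vertex in
    between. *)
Lemma linked_preceq i j : (i < j)%N -> C (lab j) (lab i) != 0 -> preceq i j.
Proof.
have [m] := ubnP (j - i)%N; elim: m i j => // m IH i j jim ij Cji.
case: (pickP [pred l : 'I_(size rw) | (i < l < j)%N && (lab l == lab i)]).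
  move=> l /andP[/andP[il lj] /eqP li]; apply: (@connect_trans _ _ l).
    by apply: IH => //; [lia | rewrite li].
  by apply: IH => //; [lia | rewrite li].
move=> none; have [ijE|ijN] := eqVneq (lab i) (lab j); last first.
  apply: connect1; rewrite /arrow Cji ij; apply/forallP => l.
  apply/implyP => /andP[il /eqP li]; rewrite ltnNge; apply/negP.
  rewrite leq_eqVlt => /predU1P[/val_inj lj|lj]; first by rewrite -li lj eqxx in ijN.
  by have := none l; rewrite /= il lj li eqxx.
have [k0 k0ij Ck0] := repeat_linked_vertex ij ijE.
pose P k := (i < k < j)%N && (C (lab k) (lab i) != 0).
have Pk0 : P k0 by rewrite /P k0ij.
(* The last linked vertex [k] is taken, so that its label does not recur up to [j] and [k] has an
   arrow to [j]. *)
case: (arg_maxnP (fun k : 'I_(size rw) => k : nat) Pk0) => k.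
move=> /andP[/andP[ik kj] Cki] kmax.
apply: (@connect_trans _ _ k); apply: connect1.
  rewrite /arrow Cki ik; apply/forallP => l; apply/implyP => /andP[il li].
  apply: leq_trans kj _; rewrite leqNgt; apply/negP => lj.
  by have := none l; rewrite /= il lj li.
rewrite /arrow -ijE C_symE Cki kj; apply/forallP => l.
apply/implyP => /andP[kl /eqP lk]; rewrite ltnNge; apply/negP.
rewrite leq_eqVlt => /predU1P[/val_inj lj|lj].
  by have := none k; rewrite /= ik kj -lk lj ijE eqxx.
have : P l by rewrite /P lj (ltn_trans ik kl) lk.
by move=> /kmax /=; rewrite leqNgt kl.
Qed.

Lemma exists_peak v : exists2 p, p \in peaks C rw & preceq p v.
Proof.
have [m] := ubnP (v : nat); elim: m v => // m IH v vm.
case: (boolP (v \in peaks C rw)) => [vp|]; first by exists v => //; apply: connect0.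
rewrite inE negb_forall => /existsP[z]; rewrite negb_imply => /andP[zv neq].
have lt : (z < v)%N by rewrite ltn_neqAle (inj_eq val_inj) neq preceq_leq.
have [|p pp pz] := IH z; first exact: leq_trans lt _.
by exists p => //; apply: connect_trans pz zv.
Qed.

Lemma pairwise_enum (V : pred 'I_(size rw)) :
  pairwise (fun i j => (i < j)%N) (filter V (enum 'I_(size rw))).
Proof.
apply: pairwise_filter.
rewrite -(pairwise_map val ltn) val_enum_ord -sorted_pairwise ?iota_ltn_sorted //.
exact: ltn_trans.
Qed.

(** With [qs] the peaks after the first, this is the set V_1 of Construction 1. *)
Definition block (qs : seq 'I_(size rw)) : pred 'I_(size rw) :=
  fun v => all (fun q => ~~ preceq q v) qs.

Lemma block_down qs i j : preceq i j -> block qs j -> block qs i.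
Proof.
move=> ij /allP bj; apply/allP => q /bj; apply: contra => qi.
exact: connect_trans qi ij.
Qed.

Lemma block_peak p qs v : perm_eq (p :: qs) (enum (peaks C rw)) ->
  block qs v -> preceq p v.
Proof.
move=> perm /allP bv; have [q qp qv] := exists_peak v.
have : q \in p :: qs by rewrite (perm_mem perm) mem_enum.
by rewrite inE => /predU1P[<- //|/bv]; rewrite qv.
Qed.

Lemma head_construction1 p qs :
  head 1%:M (construction1 C (p :: qs)) =
  word C [seq lab v | v <- filter (block qs) (enum 'I_(size rw))].
Proof.
rewrite /construction1 /=; congr (word C (map _ _)).
rewrite enumT /enum_mem; apply: eq_filter => v.
by rewrite !inE.
Qed.

(** Linked vertices are comparable by [linked_preceq], and [block qs] is closed downwards. *)
Lemma block_partition qs :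
  pairwise (fun i j => ~~ block qs i && block qs j ==> (C (lab i) (lab j) == 0))
    (enum 'I_(size rw)).
Proof.
have := pairwise_enum predT; rewrite filter_predT; apply: sub_pairwise => i j ij.
apply/implyP => /andP[bi bj]; apply: contraR bi => Cij.
by apply: block_down bj; apply: linked_preceq; rewrite // C_symE.
Qed.

(** Every vertex of the block lies above [p], so each one but [p] receives an arrow from a vertex
    which is again in the block and hence listed earlier. *)
Lemma block_one_peak p qs : perm_eq (p :: qs) (enum (peaks C rw)) ->
  one_peak C [seq lab v | v <- filter (block qs) (enum 'I_(size rw))].
Proof.
move=> perm t x u; set e := filter _ _ => lE t0.
have ke : (size t < size e)%N by rewrite -(size_map lab) lE size_cat /=; lia.
set k := size t in ke; pose v := nth p e k.
have eE : e = take k e ++ v :: drop k.+1 e by rewrite -drop_nth // cat_take_drop.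
have tE : t = map lab (take k e) by rewrite map_take lE take_size_cat.
have xE : x = lab v by rewrite /v -(nth_map p x lab) // lE nth_cat ltnn subnn.
have ltP : pairwise (fun i j : 'I_(size rw) => i < j)%N e by apply: pairwise_enum.
have ev i : i \in e -> block qs i by rewrite mem_filter => /andP[].
have ve : v \in e by apply: mem_nth.
have pv : preceq p v := block_peak perm (ev _ ve).
have pNv : p != v.
  apply/eqP => pE.
  have : exists z, z \in take k e.
    case: (take k e) tE => [tn|z s _]; first by rewrite tn in t0.
    by exists z; rewrite mem_head.
  move=> [z ze]; have zb : block qs z by apply/ev/(mem_take ze).
  have := preceq_leq (block_peak perm zb).
  move: ltP; rewrite eE pairwise_cat => /andP[/allrelP/(_ z v ze) lt _].
  by rewrite pE leqNgt lt // mem_head.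
have [z pz zv] : exists2 z, preceq p z & arrow C z v.
  move/connectP: pv => [s]; case: (lastP s) => [_ pE|r y].
    by rewrite pE eqxx in pNv.
  rewrite rcons_path last_rcons => /andP[pr ry] vE.
  exists (last p r); last by rewrite vE.
  by apply/connectP; exists r.
have ze : z \in e.
  rewrite mem_filter mem_enum andbT; apply: block_down (ev _ ve); exact: connect1.
case/and3P: zv => Cvz zv _.
exists (lab z); last by rewrite xE C_symE.
rewrite tE map_f //; move: ze; rewrite {1}eE mem_cat inE => /or3P[//|/eqP zE|zd].
  by rewrite zE ltnn in zv.
move: ltP; rewrite eE pairwise_cat /= => /and4P[_ _ /allP/(_ z zd) vz _].
by rewrite ltnNge ltnW in zv.
Qed.

(** Vertices with equal labels are comparable. A block vertex labelled like [q] would lie strictly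
    below the minimal vertex [q], or at or above it, which the block excludes. *)
Lemma other_peak q qs : q \in qs -> q \in peaks C rw ->
  lab q \notin [seq lab v | v <- filter (block qs) (enum 'I_(size rw))] /\
  lab q \in [seq lab v | v <- filter (predC (block qs)) (enum 'I_(size rw))].
Proof.
move=> qqs; rewrite inE => /forallP qpk; split; last first.
  rewrite map_f // mem_filter mem_enum andbT /=; apply/allPn.
  by exists q; rewrite ?negbK //; apply: connect0.
apply/mapP => -[v]; rewrite mem_filter => /andP[/allP/(_ q qqs) qv _] labE.
have [vq|qltv|/val_inj vq] := ltngtP v q.
- have /(implyP (qpk v))/eqP vE : preceq v q by apply: linked_preceq; rewrite -?labE.
  by rewrite vE ltnn in vq.
- by move/negP: qv; apply; apply: linked_preceq; rewrite -?labE.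
- by move/negP: qv; apply; rewrite vq; apply: connect0.
Qed.

End Quiver.

(** * Positive definiteness in types E6 and E7 *)

(* Half of the Cartan matrix, so that its quadratic form takes the value 1 on
   roots. *)
Definition half_cartanE n : 'M[int]_n :=
  \matrix_(i, j) if i == j then 1 else if edgeE i j then -1 else 0.

Lemma edgeE_lt i j : edgeE i j -> (i < j)%N.
Proof. by rewrite /edgeE !inE => /or4P[|||/or3P[]] /eqP[-> ->]. Qed.

Lemma cartanE_half n : cartanE n = half_cartanE n + (half_cartanE n)^T.
Proof.
apply/matrixP => i j; rewrite !mxE eq_sym; case: eqP => [//|_].
case: (boolP (edgeE i j)) => [/edgeE_lt ij|_];
  case: (boolP (edgeE j i)) => [/edgeE_lt ji|_] //=.
by have := ltn_trans ij ji; rewrite ltnn.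
Qed.

Lemma cartanE_off n (i j : 'I_n) : i != j -> cartanE n i j <= 0.
Proof. by move=> /negPf ij; rewrite mxE ij; case: ifP. Qed.

Lemma formE7_gt0 (a b c d e f g : int) :
  ~ [/\ a = 0, b = 0, c = 0 & [/\ d = 0, e = 0, f = 0 & g = 0]] ->
  0 < a ^+ 2 + b ^+ 2 + c ^+ 2 + d ^+ 2 + e ^+ 2 + f ^+ 2 + g ^+ 2
      - a * c - c * d - b * d - d * e - e * f - f * g.
Proof.
set q := (X in 0 < X) => nz.
(* Squares are completed from the three leaves [a], [b], [g] of the diagram towards the branch
   vertex [d], whose square is left with coefficient 1/24 in [q]. *)
have qE : q *+ 24 = (2 * a - c) ^+ 2 *+ 6 + ((3 * c - 2 * d) ^+ 2 *+ 2
  + ((2 * b - d) ^+ 2 *+ 6 + ((2 * g - f) ^+ 2 *+ 6 + ((3 * f - 2 * e) ^+ 2 *+ 2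
  + ((4 * e - 3 * d) ^+ 2 + d ^+ 2))))) by rewrite /q; ring.
have sq (x : int) k : 0 <= x ^+ 2 *+ k by rewrite mulrn_wge0 // sqr_ge0.
have sq0 (x : int) k : x ^+ 2 *+ k.+1 = 0 -> x = 0.
  by move/eqP; rewrite mulrn_eq0 /= sqrf_eq0 => /eqP.
rewrite ltNge; apply/negP => q0; apply: nz.
have split0 (x y : int) : 0 <= x -> 0 <= y -> x + y <= 0 -> x = 0 /\ y <= 0.
  by clear=> *; split; lia.
have : q *+ 24 <= 0 by rewrite pmulrn_lle0.
rewrite {}qE {q q0} => /split0[]; rewrite ?addr_ge0 ?sq ?sqr_ge0 // => /sq0 ac.
move=> /split0[]; rewrite ?addr_ge0 ?sq ?sqr_ge0 // => /sq0 cd.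
move=> /split0[]; rewrite ?addr_ge0 ?sq ?sqr_ge0 // => /sq0 bd.
move=> /split0[]; rewrite ?addr_ge0 ?sq ?sqr_ge0 // => /sq0 gf.
move=> /split0[]; rewrite ?addr_ge0 ?sq ?sqr_ge0 // => /sq0 fe.
move=> /split0[]; rewrite ?sqr_ge0 // => /(sq0 _ 0%N) ed d2.
have d0 : d = 0.
  by apply: (sq0 _ 0%N); apply/eqP; rewrite mulr1n eq_le d2 sqr_ge0.
clear -ac cd bd gf fe ed d0; subst d.
by split; [lia|lia|lia|split; lia].
Qed.

Lemma qform_half_cartanE_gt0 n (v : 'cV[int]_n) : n = 6%N \/ n = 7%N ->
  v != 0 -> 0 < qform (half_cartanE n) v.
Proof.
(* Padding by 0 turns a vector for E6 into one for E7, so one form serves both. *)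
move=> n67 v0; pose x k : int := if insub k is Some i then v i 0 else 0.
have xE (i : 'I_n) : v i 0 = x i by rewrite /x valK.
have nz : ~ [/\ x 0%N = 0, x 1%N = 0, x 2%N = 0 &
    [/\ x 3%N = 0, x 4%N = 0, x 5%N = 0 & x 6%N = 0]].
  move=> [z0 z1 z2 [z3 z4 z5 z6]]; case/eqP: v0; apply/matrixP => i j.
  rewrite ord1 xE mxE; case: i => m /= lt; have : (m < 7)%N by case: n67 lt => ->; lia.
  by clear lt; do 7 (case: m => [|m] //=).
suff -> : qform (half_cartanE n) v =
   x 0%N ^+ 2 + x 1%N ^+ 2 + x 2%N ^+ 2 + x 3%N ^+ 2 + x 4%N ^+ 2 + x 5%N ^+ 2
   + x 6%N ^+ 2 - x 0%N * x 2%N - x 2%N * x 3%N - x 1%N * x 3%N - x 3%N * x 4%N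
   - x 4%N * x 5%N - x 5%N * x 6%N by apply: formE7_gt0.
have -> : qform (half_cartanE n) v = \sum_(j < n) \sum_(i < n)
    x i * (if i == j :> nat then 1 else if edgeE i j then -1 else 0) * x j.
  rewrite /qform mxE; apply: eq_bigr => j _; rewrite mxE mulr_suml xE.
  by apply: eq_bigr => i _; rewrite !mxE xE.
have x6 : n = 6%N -> x 6%N = 0.
  by move=> n6; rewrite /x insubF // n6.
case: n67 x6 {xE nz} => nE; rewrite nE => x6.
  by rewrite !big_ord_recr !big_ord0 /edgeE /= (x6 erefl); ring.
by rewrite !big_ord_recr !big_ord0 /edgeE /=; ring.
Qed.

(** * The comparison for the first factor of Construction 1 *)

Theorem proposition4p15 (K : closedFieldType) (N n : nat)
    (G T B : set 'M[K]_N) (sr : 'I_n -> 'M[K]_N -> K)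
    (hn : n = 6%N \/ n = 7%N)
    (hG : sc_simple_group (cartanE n) G T B sr)
    (i0 : 'I_n) (hi0 : minuscule (cartanE n) i0)
    (w : 'M[int]_n)
    (hw : min_reps (cartanE n) [set i | i != i0]%classic w)
    (hw1 : w <> 1%:M)
    (rw : seq 'I_n)
    (hred : reduced (cartanE n) rw) (hrw : word (cartanE n) rw = w)
    (ps : seq 'I_(size rw))
    (hps : perm_eq ps (enum (peaks (cartanE n) rw)))
    (hsmooth : smooth
       (Xhat_space (cartanE n) G T B sr (construction1 (cartanE n) ps)))
    (a : 'I_n) :
  let w1 := head 1%:M (construction1 (cartanE n) ps) in
  neg_root (cartanE n) (invmx w1 *m simple_root a) ->
  root_ge (invmx w1 *m simple_root a) (invmx w *m simple_root a) /\
  (invmx w1 *m simple_root a = invmx w *m simple_root a <-> w = w1) /\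
  (w = w1 <-> size ps = 1%N).
Proof.
move=> w1; rewrite {}/w1 => -[_ neg]; set C := cartanE n in hps neg *.
have CE : C = half_cartanE n + (half_cartanE n)^T := cartanE_half n.
have Ad i : half_cartanE n i i = 1 by rewrite mxE eqxx.
have off (i j : 'I_n) : i != j -> C i j <= 0 := @cartanE_off n i j.
have pd (v : 'cV[int]_n) : v != 0 -> 0 < qform (half_cartanE n) v.
  exact: qform_half_cartanE_gt0.
have CT : C^T = C by rewrite CE linearD /= trmxK addrC.
have Csym i j : C i j = C j i by rewrite -[in RHS]CT [RHS]mxE.
have Cd i : C i i != 0 by rewrite mxE eqxx.
(* For symmetric [C] a root and its coroot have the same coordinates, so minuscularity of [i0]
   bounds the [i0]-coordinate of positive roots. *)
have le1 (v : 'cV[int]_n) : is_root C v -> v i0 0 <= 1.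
  move=> rv; have [v0|v0] := root_sign CE Ad off pd rv.
    apply: (hi0 v v) => //; have [s [i vE]] := rv.
    by exists s, i; rewrite CT.
  by apply: le_trans (_ : v i0 0 <= 0) _ => //; have := v0 i0; rewrite mxE oppr_ge0.
have mrw : minuscule_word C i0 rw.
  apply: (reduced_minuscule_word CE Ad off pd le1 hred) => i ii0.
  by rewrite hrw; case: (hw) => _ /(_ i ii0) [].
have rep t x u r : rw = t ++ x :: u ++ x :: r -> exists2 y, y \in u & C y x != 0.
  by move=> rwE; have := mrw; rewrite rwE => /(minuscule_word_repeat CE Ad).
case: ps hps neg {hsmooth} => [|p qs] hps neg.
  (* With no peaks [head] returns the default 1, which makes no simple root negative. *)
  by have := neg a; rewrite /= invmx1 mul1mx mxE simple_rootE eqxx.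
pose l := [seq vlabel v | v <- filter (block C qs) (enum 'I_(size rw))].
pose u := [seq vlabel v | v <- filter (predC (block C qs)) (enum 'I_(size rw))].
rewrite head_construction1 -/l in neg *.
have opk : one_peak C l := block_one_peak Csym hps.
have wE : word C (l ++ u) = w.
  rewrite -hrw -(word_partition CE (block_partition Csym Cd rep qs)).
  by rewrite /vlabel map_tnth_enum.
have mlu : minuscule_word C i0 (l ++ u).
  apply: (reduced_minuscule_word CE Ad off pd le1) => [s|i ii0]; last first.
    by rewrite wE; case: (hw) => _ /(_ i ii0) [].
  rewrite wE -hrw => /hred; rewrite size_cat !size_map -size_cat.
  by rewrite (perm_size (permEl (perm_filterC _ _))) size_enum_ord.
have actE t : act C t (simple_root a) = invmx (word C t) *m simple_root a.
  by rewrite (invmx_word CE Ad).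
rewrite -actE in neg *; rewrite -wE -actE.
split; first exact: (root_comparison CE Ad off pd le1 mlu opk neg).
(* With one peak the block is everything and [u] is empty. The label of a second peak occurs in [u]
   but not in [l], and then all three conditions fail. *)
case: qs => [|q qs] in hps l u neg opk wE mlu *.
  have u0 : u = [::].
    by rewrite /u (eq_filter (a2 := pred0)) // filter_pred0.
  by rewrite u0 cats0.
have qpk : q \in peaks C rw.
  by rewrite -mem_enum -(perm_mem hps) !inE eqxx orbT.
have [ql qu] := other_peak Csym Cd rep (mem_head q qs) qpk.
have neq := root_comparison_strict CE Ad off pd le1 mlu opk neg qu ql.
have neqw : word C (l ++ u) <> word C l by move=> E; apply: neq; rewrite !actE E.
by split; split.
Qed.
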